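(* Let $G=(V,E)$ be a graph. For each edge subset $B\subseteq E$ such that the spanning subgraph $(V,B)$ is bipartite, fix a bipartition $V=Y_B\cup Z_B$ of $(V,B)$, let $(V_1,E_1),\dots,(V_k,E_k)$ be the components of $(V,B)$ with nonempty edge sets, let $l$ be the number of components of $(V,B)$ that are isomorphic to $K_1$ (isolated vertices), and put $$h(B)=x^{l}\prod_{i=1}^{k}(-1)^{|E_i|}\left[(-1)^{|Y_B\cap V_i|}x^{|Z_B\cap V_i|}+(-1)^{|Z_B\cap V_i|}x^{|Y_B\cap V_i|}\right].$$ Then $$D(G,x)=\sum_{\substack{B\subseteq E\\ (V,B)\text{ is bipartite}}}h(B).$$
   Context: All graphs are finite, simple and undirected. For a graph $G=(V,E)$, the closed neighborhood $N_G[v]$ of a vertex $v$ is the set consisting of $v$ and all its neighbors, and $N_G[W]=\bigcup_{v\in W}N_G[v]$ for $W\subseteq V$. A set $W\subseteq V$ is dominating in $G$ if $N_G[W]=V$. The domination polynomial is $D(G,x)=\sum_{k=0}^{|V|}d_k(G)x^k$, where $d_k(G)$ is the number of dominating sets of $G$ of cardinality $k$. A graph with vertex set $V$ is bipartite with bipartition $V=Y\cup Z$ if $Y,Z$ are disjoint (possibly empty) and every edge has one end vertex in $Y$ and the other in $Z$. Empty products are equal to $1$. (The quantities $k$, $l$, $V_i$, $E_i$ depend on $B$.) *)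

(* Defs.v *)
From mathcomp Require Import all_boot all_algebra.

Set Implicit Arguments.
Unset Strict Implicit.
Unset Printing Implicit Defensive.

Import GRing.Theory.
Local Open Scope ring_scope.

(* A graph on the vertex type V is given by its edge set E : {set {set V}},
   whose members are the unordered pairs [set u; v] with u != v.  The spanning
   subgraph (V, B) for B \subset E is then given by B itself. *)

Definition simple_graph (V : finType) (E : {set {set V}}) : Prop :=
  forall f, f \in E -> #|f| = 2%N.

Definition adj (V : finType) (E : {set {set V}}) : rel V :=
  [rel u v | [set u; v] \in E].

Definition closed_nbhd (V : finType) (E : {set {set V}}) (v : V) : {set V} :=
  [set u | (u == v) || adj E v u].

Definition closed_nbhds (V : finType) (E : {set {set V}}) (W : {set V}) :
    {set V} :=
  \bigcup_(v in W) closed_nbhd E v.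

Definition dominating (V : finType) (E : {set {set V}}) (W : {set V}) : bool :=
  closed_nbhds E W == [set: V].

Definition num_dominating (V : finType) (E : {set {set V}}) (k : nat) : nat :=
  #|[set W : {set V} | dominating E W & #|W| == k]|.

Definition domination_poly (V : finType) (E : {set {set V}}) : {poly int} :=
  \sum_(0 <= k < #|V|.+1) (num_dominating E k)%:R * 'X^k.

Definition is_bipartition (V : finType) (E : {set {set V}}) (Y Z : {set V}) :
    bool :=
  [&& [disjoint Y & Z], Y :|: Z == [set: V] &
      [forall f in E, exists y in Y, exists z in Z, f == [set y; z]]].

Definition bipartite (V : finType) (E : {set {set V}}) : bool :=
  [exists Y : {set V}, exists Z : {set V}, is_bipartition E Y Z].

(* A component is represented by its vertex set. *)
Definition components (V : finType) (E : {set {set V}}) : {set {set V}} :=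
  equivalence_partition (connect (adj E)) [set: V].

(* When C is a component of (V, E), these are exactly the edges of C. *)
Definition edges_in (V : finType) (E : {set {set V}}) (C : {set V}) :
    {set {set V}} :=
  [set f in E | f \subset C].

(* A component of a simple graph is isomorphic to K_1 iff it has exactly one
   vertex. *)
Definition num_isolated (V : finType) (E : {set {set V}}) : nat :=
  #|[set C in components E | #|C| == 1%N]|.

(* Y, Z stand for the bipartition Y_B, Z_B fixed for (V, B). *)
Definition h_poly (V : finType) (B : {set {set V}}) (Y Z : {set V}) :
    {poly int} :=
  'X^(num_isolated B) *
  \prod_(C in components B | edges_in B C != set0)
    ((-1) ^+ #|edges_in B C| *
     ((-1) ^+ #|Y :&: C| * 'X^#|Z :&: C| +
      (-1) ^+ #|Z :&: C| * 'X^#|Y :&: C|)).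

(* Main.v *)
(** Inclusion-exclusion over the undominated vertices and then over the edges
    joining [U] to [W] writes [D(G,x)] as the sum over [B] of [(-1)^|B|] times
    the sum of [(-1)^|U| x^|W|] over the disjoint pairs [(U, W)] such that every
    edge of [B] joins [U] to [W].  There is no such pair unless [(V, B)] is
    bipartite, and then the inner sum factors over the components: one with an
    edge is split between [U] and [W] along its bipartition, in one of two ways,
    while an isolated vertex lies in [U], in [W] or in neither, contributing
    [-1 + x + 1 = x]. *)

Require Import Defs.
From mathcomp Require Import all_boot all_algebra.

Set Implicit Arguments.
Unset Strict Implicit.
Unset Printing Implicit Defensive.

Import GRing.Theory.
Local Open Scope ring_scope.

(** * Inclusion-exclusion and sums over disjoint pairs *)

(** Expanding a product of factors [-1 + 1] over [A] and [0 + 1] off [A] leaves the signs of the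
    subsets of [A]; any element of [A] makes the product vanish. *)
Lemma alternating_sum_subsets (R : comNzRingType) (T : finType) (A : {set T}) :
  \sum_(U : {set T} | U \subset A) (-1) ^+ #|U| = (A == set0)%:R :> R.
Proof.
transitivity (\prod_i ((if i \in A then -1 else 0) + 1) : R).
  rewrite bigA_distr big_mkcond; apply: eq_bigr => U _.
  case: ifP => [sUA | /negbT/subsetPn[i iU iA]]; last first.
    by rewrite (bigD1 i) //= iU (negPf iA) mul0r.
  rewrite -big_mkcond -prodr_const; apply: eq_bigr => i iU.
  by rewrite (subsetP sUA).
have [->|[i iA]] := set_0Vmem A.
  by rewrite eqxx big1 // => i _; rewrite inE add0r.
rewrite (bigD1 i) //= iA addNr mul0r (_ : _ == _ = false) //.
by apply/negbTE/set0Pn; exists i.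
Qed.

(** Convertible to the edge clause of [is_bipartition], but meant also for [U] and [W] that do not
    cover [V]. *)
Definition joins (V : finType) (U W : {set V}) (f : {set V}) : bool :=
  [exists u in U, exists w in W, f == [set u; w]].

Lemma joinsP (V : finType) (U W f : {set V}) :
  reflect (exists u w, [/\ u \in U, w \in W & f = [set u; w]]) (joins U W f).
Proof.
apply: (iffP existsP) => [[u /andP[uU /existsP[w /andP[wW /eqP->]]]]|].
  by exists u, w.
case=> u [w [uU wW ->]]; exists u; rewrite uU; apply/existsP; exists w.
by rewrite wW /=.
Qed.

Lemma joinsS (V : finType) (U W U' W' f : {set V}) :
  U \subset U' -> W \subset W' -> joins U W f -> joins U' W' f.
Proof.
move=> sU sW /joinsP[u [w [uU wW ->]]]; apply/joinsP; exists u, w.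
by rewrite (subsetP sU) ?(subsetP sW).
Qed.

(** Phrasing undomination as the emptiness of an edge set prepares the second inclusion-exclusion,
    which runs over the subsets of that set. *)
Lemma subset_closed_nbhdsC (V : finType) (E : {set {set V}}) (U W : {set V}) :
  (U \subset ~: closed_nbhds E W) =
  [disjoint U & W] && ([set f in E | joins U W f] == set0).
Proof.
apply/idP/andP => [sU | [dUW /eqP E0]].
  have notN u w : u \in U -> w \in W -> (u != w) && ([set w; u] \notin E).
    move=> uU wW; have := subsetP sU u uU; rewrite !inE -negb_or.
    by apply: contra => uw; apply/bigcupP; exists w => //; rewrite !inE.
  split.
    rewrite -setI_eq0; apply/eqP/setP=> u; rewrite !inE.
    apply/negbTE/negP => /andP[uU uW].
    by have := notN u u uU uW; rewrite eqxx.
  apply/eqP/setP=> f; rewrite !inE; apply/negbTE/negP.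
  case/andP=> fE /joinsP[u [w [uU wW fuw]]].
  by have := notN u w uU wW; rewrite setUC -fuw fE andbF.
apply/subsetP=> u uU; rewrite inE; apply/negP => /bigcupP[w wW].
rewrite !inE => /orP[/eqP uw | wu].
  by have := disjointFr dUW uU; rewrite uw wW.
have: [set w; u] \in [set f in E | joins U W f].
  rewrite inE [_ \in E]wu; apply/joinsP; exists u, w.
  by rewrite uU wW setUC.
by rewrite E0 inE.
Qed.

Lemma domination_polyE (V : finType) (E : {set {set V}}) :
  domination_poly E = \sum_(W | dominating E W) 'X^#|W|.
Proof.
rewrite /domination_poly big_mkord.
rewrite (partition_big (fun W : {set V} => inord #|W| : 'I_#|V|.+1) xpredT) //=.
apply: eq_bigr => k _; rewrite /num_dominating -sum1dep_card natr_sum.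
rewrite mulr_suml; apply: eq_big => [W | W /andP[_ /eqP->]]; last by rewrite mul1r.
congr (_ && _); rewrite -val_eqE /= inordK // ltnS.
exact: max_card.
Qed.

(* Inclusion-exclusion twice: over the undominated vertices, then over the
   edges joining [U] to [W]. *)
Lemma domination_poly_joins (V : finType) (E : {set {set V}}) :
  domination_poly E =
  \sum_(B : {set {set V}} | B \subset E)
    (-1) ^+ #|B| *
    \sum_(p : {set V} * {set V} |
           [disjoint p.1 & p.2] && [forall f in B, joins p.1 p.2 f])
       (-1) ^+ #|p.1| * 'X^#|p.2|.
Proof.
rewrite domination_polyE.
pose S := \sum_(p : {set V} * {set V} | [disjoint p.1 & p.2])
  \sum_(B : {set {set V}} | (B \subset E) && [forall f in B, joins p.1 p.2 f])
    (-1) ^+ #|B| * ((-1) ^+ #|p.1| * 'X^#|p.2|) : {poly int}.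
transitivity S; last first.
  rewrite /S (exchange_big_dep (fun B : {set {set V}} => B \subset E)) /=.
    apply: eq_bigr => B sBE; rewrite mulr_sumr; apply: eq_bigl => p.
    by rewrite sBE.
  by move=> p B _ /andP[].
rewrite /S big_mkcond /=.
under eq_bigr => W _.
  (* The indicator that [W] leaves no vertex undominated is an alternating sum over sets [U] of
     undominated vertices. *)
  have -> : (if dominating E W then 'X^#|W| else 0) =
      \sum_(U : {set V} | U \subset ~: closed_nbhds E W)
         (-1) ^+ #|U| * 'X^#|W| :> {poly int}.
    rewrite -mulr_suml alternating_sum_subsets /dominating -setCT.
    by rewrite (inj_eq (@setC_inj V)); case: ifP; rewrite ?mul1r ?mul0r.
over.
rewrite (exchange_big_dep xpredT) //= pair_big_dep /=.
rewrite big_mkcond [RHS]big_mkcond; apply: eq_bigr => -[U W] _ /=.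
rewrite subset_closed_nbhdsC.
have [dUW|] := boolP [disjoint U & W]; last by [].
rewrite -mulr_suml.
(* For fixed [U] and [W], the sets [B] are all the subsets of one set of edges, so their signs sum
   to the indicator that it is empty. *)
under [in RHS]eq_bigl => B.
  have -> : (B \subset E) && [forall f in B, joins U W f] =
      (B \subset [set f in E | joins U W f]).
    apply/andP/subsetP => [[/subsetP sBE /forall_inP sBJ] f fB | sB].
      by rewrite inE sBE // sBJ.
    split; first by apply/subsetP => f /sB; rewrite inE => /andP[].
    by apply/forall_inP => f /sB; rewrite inE => /andP[].
over.
rewrite alternating_sum_subsets /=.
by case: (_ == set0); rewrite ?mul1r ?mul0r.
Qed.

(* A pair [(U, W)] is coded by the colouring [g] with [g v = None] off
   [U :|: W], the colours being twisted by [A]: when [A] is one side of a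
   bipartition of [(V, B)], the edges of [B] join [U] to [W] exactly when their
   two ends have the same colour, distinct from [None]. *)
Lemma sum_disjoint_pairs (V : finType) (A : {set V}) (R : comNzRingType)
    (x : R) (P : pred ({set V} * {set V})) :
  let UW (g : {ffun V -> option bool}) :=
    ([set v | g v == Some (v \in A)], [set v | g v == Some (v \notin A)]) in
  \sum_(p : {set V} * {set V} | [disjoint p.1 & p.2] && P p)
     (-1) ^+ #|p.1| * x ^+ #|p.2| =
  \sum_(g : {ffun V -> option bool} | P (UW g))
     \prod_v if g v is Some b then (if b == (v \in A) then -1 else x) else 1.
Proof.
move=> UW.
(* [col] inverts [UW] on disjoint pairs. *)
pose col (p : {set V} * {set V}) : {ffun V -> option bool} :=
  [ffun v => if v \in p.1 then Some (v \in A)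
             else if v \in p.2 then Some (v \notin A) else None].
have disj g : [disjoint (UW g).1 & (UW g).2].
  rewrite -setI_eq0; apply/eqP/setP => v; rewrite !inE.
  by case: (g v) => [[]|]; case: (v \in A).
rewrite (reindex_onto UW col) /=; last first.
  move=> [U W] /andP[/= dUW _]; congr pair; apply/setP=> v; rewrite !inE ffunE /=.
    by case: (v \in U); case: (v \in W); case: (v \in A).
  have := disjointFr dUW (x := v).
  by case: (v \in U) => [->|_] //; case: (v \in W); case: (v \in A).
apply: eq_big => [g | g _].
  rewrite disj /= andb_idr // => _; apply/eqP/ffunP=> v; rewrite ffunE !inE /=.
  by case: (g v) => [[]|]; case: (v \in A).
rewrite -!prodr_const [X in X * _]big_mkcond [X in _ * X]big_mkcond -big_split.
apply: eq_bigr => v _ /=; rewrite !inE.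
by case: (g v) => [[]|]; case: (v \in A); rewrite /= ?mul1r ?mulr1.
Qed.

(** * Components of the spanning subgraph and colourings constant on them *)

Section Components.
Variables (V : finType) (B : {set {set V}}).
Hypothesis simpleB : simple_graph B.

Let adj_sym : symmetric (adj B).
Proof. by move=> u v; rewrite /adj /= setUC. Qed.

Let connect_equiv : {in [set: V] & &, equivalence_rel (connect (adj B))}.
Proof.
have cs : connect_sym (adj B) := sym_connect_sym adj_sym.
move=> u v w _ _ _; split=> [|uv]; first exact: connect0.
exact: (same_connect cs uv).
Qed.

Lemma components_partition : partition (components B) [set: V].
Proof. exact: equivalence_partitionP. Qed.

Lemma mem_component u v : (v \in pblock (components B) u) = connect (adj B) u v.
Proof. exact: pblock_equivalence_partition. Qed.

Lemma component_pblock C u : C \in components B -> u \in C -> pblock (components B) u = C.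
Proof.
by move=> CP uC; case/and3P: components_partition => _ tI _; apply: def_pblock.
Qed.

Lemma pblock_component u : pblock (components B) u \in components B.
Proof.
by case/and3P: components_partition => /eqP cP _ _; rewrite pblock_mem // cP.
Qed.

Lemma edge_component u v : [set u; v] \in B ->
  pblock (components B) u = pblock (components B) v.
Proof.
move=> uv; apply: component_pblock (pblock_component _) _.
by rewrite mem_component connect1 // /adj /= setUC.
Qed.

Lemma edges_in_eq0 C : C \in components B ->
  (edges_in B C == set0) = (#|C| == 1%N).
Proof.
move=> CP; apply/eqP/cards1P => [E0 | [u Cu]]; last first.
  apply/setP=> f; rewrite !inE; apply/negbTE/negP => /andP[/simpleB f2].
  by move/subset_leq_card; rewrite f2 Cu cards1.
have [C0|[u uC]] := set_0Vmem C.
  by case/and3P: components_partition => _ _; rewrite -C0 CP.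
exists u; apply/setP=> v; rewrite inE.
rewrite -(component_pblock CP uC) mem_component; apply/idP/eqP => [|->]; last first.
  exact: connect0.
(* A path from [u] to another vertex would start with an edge inside [C]. *)
case/connectP => -[|w p] /=; first by [].
case/andP => uw _ _.
suff: [set u; w] \in edges_in B C by rewrite E0 inE.
rewrite inE [_ \in B]uw; apply/subsetP => t; rewrite !inE.
by case/orP => /eqP-> //; rewrite -(component_pblock CP uC) mem_component connect1.
Qed.

(** Double counting: each edge lies in exactly one component, that of either end. *)
Lemma card_edges_components :
  #|B| = (\sum_(C in components B) #|edges_in B C|)%N.
Proof.
under eq_bigr => C _ do rewrite -sum1dep_card.
rewrite (exchange_big_dep (fun f : {set V} => f \in B)) /=; last first.
  by move=> C f _ /andP[].
rewrite -sum1_card; apply: eq_bigr => f fB.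
have /eqP/cards2P[u [v [_ fuv]]] := simpleB fB.
rewrite (big_pred1 (pblock (components B) u)) // => C /=.
rewrite fB fuv /=; apply/andP/eqP => [[CP sC] | ->].
  by rewrite (component_pblock CP) // (subsetP sC) // !inE eqxx.
split; first exact: pblock_component.
apply/subsetP => t; rewrite !inE mem_component => /orP[] /eqP->.
  exact: connect0.
by rewrite connect1 // /adj /= -fuv.
Qed.

Lemma sign_edges_components (R : comNzRingType) :
  (-1) ^+ #|B| =
  \prod_(C in components B | edges_in B C != set0) (-1) ^+ #|edges_in B C| :> R.
Proof.
rewrite card_edges_components -prodrXr [LHS](bigID (fun C => edges_in B C != set0)) /=.
rewrite [X in _ * X]big1 ?mulr1 // => C /andP[_ /negPn/eqP->].
by rewrite cards0.
Qed.

(** The colourings on the left are constant on components and avoid [None] wherever there is an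
    edge. Each is thus a free choice of one colour per component, and distributivity gives the
    product. *)
Lemma sum_component_colorings (R : comNzRingType) (F : V -> option bool -> R) :
  \sum_(g : {ffun V -> option bool} |
        [forall u, forall v, adj B u v ==> (g u == g v) && (g u != None)])
     \prod_v F v (g v) =
  \prod_(C in components B)
    \sum_(c | (c != None) || (edges_in B C == set0)) \prod_(v in C) F v c.
Proof.
pose lift (h : {ffun {set V} -> option bool}) : {ffun V -> option bool} :=
  [ffun v => h (pblock (components B) v)].
(* The colour of [C] is read at any of its vertices. Sets that are not components get [None], the
   default value in [big_distr_big_dep]. *)
pose desc (g : {ffun V -> option bool}) : {ffun {set V} -> option bool} :=
  [ffun C : {set V} => if [pick v in C | C \in components B] is Some v then g v else None].
rewrite (big_distr_big_dep None) /=.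
rewrite (reindex_onto lift desc) /=; last first.
  move=> g /forallP gB; apply/ffunP=> v; rewrite !ffunE.
  case: pickP => [u|/(_ v)]; last by rewrite pblock_component mem_component connect0.
  case/andP; rewrite mem_component => vu _.
  (* Each colour class is closed under adjacency, hence a union of components. *)
  have cl : closed (adj B) [pred w | g w == g v].
    move=> a b ab; have /forallP/(_ b)/implyP/(_ ab)/andP[/eqP gab _] := gB a.
    by rewrite !inE gab.
  by have := closed_connect cl vu; rewrite !inE eqxx => /esym/eqP.
have [/eqP coverV tI nE0] := and3P components_partition.
apply: eq_big => [h | h _]; last first.
  rewrite -[LHS](eq_bigl _ _ (in_setT (T := V))) -coverV big_trivIset //=.
  apply: eq_bigr => C CP; apply: eq_bigr => v vC.
  by rewrite ffunE (component_pblock CP).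
apply/andP/pfamilyP => [[/forallP hB /eqP hK] | [/subsetP supp hQ]].
  split; first apply/subsetP => C.
    rewrite inE -hK ffunE; by case: pickP => [v /andP[]|] //=.
  move=> C CP; rewrite unfold_in; case: eqP => //= hC; apply/negPn/negP.
  case/set0Pn => f; rewrite inE => /andP[fB sfC].
  have /eqP/cards2P[u [v [_ fuv]]] := simpleB fB.
  have uC : u \in C by rewrite (subsetP sfC) // fuv !inE eqxx.
  have /forallP/(_ v) := hB u.
  by rewrite /adj /= -fuv fB !ffunE (component_pblock CP uC) hC andbF.
split.
  apply/forallP => u; apply/forallP => v; apply/implyP => uv.
  rewrite !ffunE -(edge_component uv) eqxx /=.
  have := hQ _ (pblock_component u); rewrite unfold_in => /orP[] //.
  move=> /eqP/setP/(_ [set u; v]); rewrite !inE [_ \in B]uv /=.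
  case/subsetP => t; rewrite !inE mem_component => /orP[] /eqP->.
    exact: connect0.
  exact: connect1.
apply/eqP/ffunP => C; rewrite ffunE; case: pickP => [v /andP[vC CP]|noC].
  by rewrite ffunE (component_pblock CP vC).
have [CP|CP] := boolP (C \in components B).
  have [C0|[v vC]] := set_0Vmem C; first by rewrite -C0 CP in nE0.
  by have := noC v; rewrite vC CP.
by apply/esym/eqP; apply: contraNT CP; apply: supp.
Qed.

End Components.

(** * Evaluation of the inner sum for a bipartite edge set *)

Section Bipartition.
Variables (V : finType) (B : {set {set V}}) (Y Z : {set V}).
Hypothesis simpleB : simple_graph B.
Hypothesis bipYZ : is_bipartition B Y Z.

Lemma bipartition_mem v : (v \in Z) = (v \notin Y).
Proof.
case/and3P: bipYZ => dYZ /eqP/setP/(_ v); rewrite !inE => YZv _.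
have [vY|vY] := boolP (v \in Y); first by rewrite (disjointFr dYZ).
by rewrite (negPf vY) in YZv.
Qed.

Lemma bipartition_adj u v : adj B u v -> (u \in Y) = (v \notin Y).
Proof.
case/and3P: bipYZ => _ _ /forall_inP/(_ [set u; v]) uvJ uv.
have /joinsP[y [z [yY]]] : joins Y Z [set u; v] := uvJ uv.
rewrite bipartition_mem => zY uvE.
have := uv; rewrite /adj /=; move/simpleB; rewrite cards2; case: eqP => // uDv _.
have : (y \in [set u; v]) && (z \in [set u; v]) by rewrite uvE !inE !eqxx orbT.
have yDz : y != z by apply: contraTneq yY => ->.
(* Since [y] and [z] differ, they are [u] and [v] in one of the two orders; the other two cases are
   contradictory. *)
rewrite !inE => /andP[/orP[]/eqP eqy /orP[]/eqP eqz]; subst y z.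
- by rewrite eqxx in yDz.
- by rewrite yY zY.
- by rewrite yY (negPf zY).
- by rewrite eqxx in yDz.
Qed.

Lemma joins_bipartition (g : {ffun V -> option bool}) :
  [forall f in B, joins [set v | g v == Some (v \in Y)]
                        [set v | g v == Some (v \notin Y)] f] =
  [forall u, forall v, adj B u v ==> (g u == g v) && (g u != None)].
Proof.
apply/forall_inP/forallP => [gJ u | gB f fB].
  apply/forallP => v; apply/implyP => uv.
  have /joinsP[a [b []]] := gJ _ uv; rewrite !inE => /eqP ga /eqP gb uvE.
  have ab : adj B a b by rewrite /adj /= -uvE.
  have gab : g a = g b by rewrite ga gb (bipartition_adj ab).
  have gS w : w \in [set u; v] -> g w = g a.
    by rewrite uvE !inE => /orP[] /eqP->.
  by rewrite !gS ?ga ?eqxx // !inE eqxx ?orbT.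
have /eqP/cards2P[u [v [_ fuv]]] := simpleB fB.
have uv : adj B u v by rewrite /adj /= -fuv.
have /forallP/(_ v)/implyP/(_ uv)/andP[/eqP guv] := gB u.
have Yuv := bipartition_adj uv.
case gu: (g u) => [b|] // _; apply/joinsP.
(* The common colour decides which end lies in [U]: the one whose membership in [Y] is [b]. *)
have [bu|bu] := eqVneq b (u \in Y); [exists u, v | exists v, u].
  by rewrite !inE -guv gu bu fuv -Yuv !eqxx.
by rewrite !inE -guv gu setUC fuv; case: b bu {gu}; rewrite Yuv; case: (v \in Y).
Qed.

(** On a component with an edge, the colour [Some true] puts its [Y] part in [U] and its [Z] part in
    [W]; [Some false] does the reverse. These are the two terms of its factor. *)
Lemma sum_joins_h_poly :
  (-1) ^+ #|B| *
    (\sum_(p : {set V} * {set V} |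
           [disjoint p.1 & p.2] && [forall f in B, joins p.1 p.2 f])
       (-1) ^+ #|p.1| * 'X^#|p.2|) = h_poly B Y Z.
Proof.
rewrite (sum_disjoint_pairs Y 'X (fun p => [forall f in B, joins p.1 p.2 f])).
rewrite (eq_bigl _ _ joins_bipartition).
rewrite (sum_component_colorings simpleB (fun v c =>
  if c is Some b then (if b == (v \in Y) then -1 else 'X) else 1)).
rewrite (sign_edges_components simpleB) /h_poly big_split /=.
rewrite [RHS]mulrCA; congr (_ * _).
rewrite (bigID (fun C => edges_in B C == set0)) /=; congr (_ * _).
  rewrite /num_isolated -sum1dep_card -prodrXr.
  apply: eq_big => [C | C /andP[CP EC]].
    by case: (boolP (C \in _)) => //= CP; rewrite edges_in_eq0.
  rewrite EC; move: EC; rewrite edges_in_eq0 // => /cards1P[v ->].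
  (* At an isolated vertex [None] contributes [1], and the other two colours contribute [-1] and
     ['X] in an order depending on [v \in Y]. *)
  rewrite (bigD1 None) // (bigD1 (Some true)) // (bigD1 (Some false)) //=.
  rewrite [X in _ + (_ + (_ + X))]big1 => [|[[]|]] //; rewrite !big_set1 addr0.
  by case: (v \in Y); rewrite ?(addrC 'X) addrA subrr add0r.
apply: eq_bigr => C /andP[CP /negPf EC].
rewrite EC (bigD1 (Some true)) // (bigD1 (Some false)) //=.
rewrite [X in _ + (_ + X)]big1 ?addr0 => [|[[]|]] //.
congr (_ + _); rewrite -!prodr_const big_mkcond [X in X * _]big_mkcond;
  rewrite [X in _ * X]big_mkcond -big_split; apply: eq_bigr => v _ /=;
  rewrite !inE bipartition_mem;
  by case: (v \in Y); case: (v \in C); rewrite ?mul1r ?mulr1.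
Qed.

End Bipartition.

Theorem mainTheorem1 (V : finType) (E : {set {set V}})
    (hE : simple_graph E)
    (Y Z : {set {set V}} -> {set V})
    (hYZ : forall B : {set {set V}},
       B \subset E -> bipartite B -> is_bipartition B (Y B) (Z B)) :
  domination_poly E
  = \sum_(B : {set {set V}} | (B \subset E) && bipartite B)
      h_poly B (Y B) (Z B).
Proof.
rewrite domination_poly_joins [LHS](bigID (@bipartite V)) /=.
rewrite [X in _ + X]big1 ?addr0 => [|B /andP[_ nbB]].
  apply: eq_bigr => B /andP[sBE bB]; apply: (sum_joins_h_poly _ (hYZ _ sBE bB)).
  by move=> f fB; apply/hE/(subsetP sBE).
(* For non-bipartite [B] the inner sum is empty: enlarging [W] to the complement of [U] would turn a
   pair into a bipartition. *)
rewrite big1 ?mulr0 // => -[U W] /andP[/= dUW UWJ]; case/negP: nbB.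
apply/existsP; exists U; apply/existsP; exists (~: U).
rewrite /is_bipartition setUCr eqxx -setI_eq0 setICr eqxx /=.
apply/forall_inP => f fB; have := forall_inP UWJ f fB.
by apply: joinsS => //; rewrite subsets_disjoint setCK disjoint_sym.
Qed.
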